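(* Let $n\geq 2$ and let $\mathcal{C}$ be a conjugacy class of involutions in $\mathbb{S}_n$ or in $\mathbb{A}_n$. Then the Killing form $K_{\mathcal{C}}$ is non-degenerate, unless $n=4$ and $\mathcal{C}$ is the conjugacy class of $(1\ 2)(3\ 4)$.
   Context: $\mathbb{S}_n$ and $\mathbb{A}_n$ are the symmetric and alternating groups on $\{1,\dots,n\}$. An involution is an element of order $2$. For a subset $\mathcal{C}\subset G\setminus\{1\}$ of a finite group $G$ stable under conjugation by $G$, let $\mathbb{C}\mathcal{C}$ be the complex vector space with basis $\mathcal{C}$. The Killing form $K_{\mathcal{C}}$ is the bilinear form on $\mathbb{C}\mathcal{C}$ given on basis elements $a,b\in\mathcal{C}$ by $K_{\mathcal{C}}(a,b)=|C_G(ab)\cap\mathcal{C}|$, where $C_G(ab)$ is the centralizer of $ab$ in $G$. It is non-degenerate if the matrix $(K_{\mathcal{C}}(a,b))_{a,b\in\mathcal{C}}$ is invertible. Here $G$ is the group ($\mathbb{S}_n$ or $\mathbb{A}_n$) in which $\mathcal{C}$ is a conjugacy class. *)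

(* Defs.v *)
From mathcomp Require Import all_boot all_order all_algebra.
From mathcomp Require Import all_fingroup all_solvable.
From mathcomp Require Import reals complex.

Set Implicit Arguments.
Unset Strict Implicit.
Unset Printing Implicit Defensive.

Import GroupScope GRing.Theory.
Local Open Scope ring_scope.

Section KillingForm.
Variables (F : fieldType) (gT : finGroupType).
Implicit Types (G C : {set gT}) (a b : gT).

Definition killing G C a b : nat := #|'C_G[(a * b)%g] :&: C|.

(* The space with basis C is the space of row vectors of length #|C|; the     *)
(* basis vector attached to enum_val i : gT is delta_mx 0 i.                  *)
Definition killing_form G C (u v : 'rV[F]_#|C|) : F :=
  \sum_i \sum_j u 0 i * v 0 j * (killing G C (enum_val i) (enum_val j))%:R.

Definition gram_mx m (B : 'rV[F]_m -> 'rV[F]_m -> F) : 'M[F]_m :=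
  \matrix_(i, j) B (delta_mx 0 i) (delta_mx 0 j).

Definition nondegenerate_form m (B : 'rV[F]_m -> 'rV[F]_m -> F) : bool :=
  gram_mx B \in unitmx.

Lemma killing_formE G C :
  gram_mx (@killing_form G C) =
  \matrix_(i, j) (killing G C (enum_val i) (enum_val j))%:R.
Proof.
apply/matrixP => i j; rewrite !mxE /killing_form.
rewrite (bigD1 i) //= (bigD1 j) //= !mxE !eqxx !mul1r.
rewrite big1 ?addr0 => [|k /negPf kj]; last first.
  by rewrite !mxE kj andbF mulr0 mul0r.
rewrite big1 ?addr0 // => k /negPf ki.
by rewrite big1 // => l _; rewrite !mxE ki andbF !mul0r.
Qed.

End KillingForm.

(* Points are numbered from 0, so this is the permutation (1 2)(3 4).         *)
Definition double_transposition : 'S_4 :=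
  (tperm (inord 0) (inord 1) * tperm (inord 2) (inord 3))%g.

(* Main.v *)
Require Import Defs.
From mathcomp Require Import all_boot all_order all_algebra.
From mathcomp Require Import all_fingroup all_solvable.
From mathcomp Require Import reals complex.
From mathcomp Require Import zify.

(** For involutions a and b, an element x commutes with ab exactly when
    x ^ a = x ^ b. Hence K(a, b) is the number of pairs (x, y) of elements of C
    with x ^ a = y = x ^ b: the matrix K is the Gram matrix of the permutation
    matrices of the elements of C acting on C by conjugation, and K is
    invertible if and only if these permutation matrices are linearly
    independent over the complex numbers (the useful direction is
    [separated_nondegenerate]). They are so if for each a in C there is x in C
    such that a is the only element of C conjugating x to x ^ a: the entry
    (x, x ^ a) of a linear combination is then the coefficient of a.

    Such an x is found with graphs ([unique_conjugator]). Let the elements of C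
    have k 2-cycles on n points, and view the 2-cycles of x and of y = x ^ a as
    edges of two colours; a is an automorphism of order 2 exchanging the
    colours. If n > 2k, let the edges form an alternating path with 2k + 1
    vertices: its only colour-exchanging automorphism is the reversal, which has
    k 2-cycles already. If n = 2k with k odd, let the edges form an alternating
    cycle of length 2k: its colour-exchanging involutions are the reflections
    through a vertex, which have fixed points, and the antipodal map. If n = 2k
    with k even and k > 2, use a cycle of length 2k - 2 and an edge of both
    colours, which any solution must preserve. By conjugation the property
    passes to the whole class, because involutions with equally many moved
    points are conjugate, even in the alternating group ([involution_class]).

    For n = 4 and k = 2 the three elements of C commute with each other, so all
    entries of K are equal. *)

(** * Linear independence of the conjugation operators *)

Section KillingGram.
Set Implicit Arguments.
Unset Strict Implicit.
Unset Printing Implicit Defensive.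
Import Order.TTheory GRing.Theory Num.Theory GroupScope.
Local Open Scope ring_scope.

(** Conjugating x by ab fixes it exactly when a and b = b^-1 move it to the same
    place; so K(a, b) is the trace of the product of the operators of a and b. *)
Lemma killing_sum (gT : finGroupType) (G C : {set gT}) (a b : gT) :
  C \subset G -> #[b]%g = 2%N ->
  killing G C a b = (\sum_(x in C) (x ^ a == x ^ b)%g)%N.
Proof.
move=> CG ob; have bV : (b^-1 = b)%g.
  by apply/eqP; rewrite eq_invg_mul -expg2 -ob expg_order.
have cE x : (x \in 'C[a * b]%g) = (x ^ a == x ^ b)%g.
  rewrite (sameP cent1P commgP) -(sameP eqP conjg_fixP).
  by rewrite conjgM -(inj_eq (conjg_inj b)) -conjgM -[X in (b * X)%g]bV mulgV conjg1.
rewrite /killing -sum1_card big_mkcond [RHS]big_mkcond /=.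
apply: eq_bigr => x _; rewrite in_setI in_setI cE andbC.
by case: (boolP (x \in C)) => //= /(subsetP CG)->.
Qed.

(** The permutation matrix of a then has a nonzero entry at (x, x ^ a), where
    those of the other elements of C vanish. *)
Definition separated (gT : finGroupType) (C : {set gT}) (a : gT) : Prop :=
  exists2 x, x \in C & forall b, b \in C -> (x ^ b = x ^ a)%g -> b = a.

(** The matrix K is the Gram matrix of the 0/1 vectors ([x ^ a == y])_(x, y).
    Separation provides for each a a coordinate (x, y) where the vector of a is
    the only nonzero one, whence linear independence. *)
Lemma separated_nondegenerate (F : numClosedFieldType) (gT : finGroupType)
    (G C : {set gT}) :
    C \subset G ->
    (forall x, x \in C -> #[x]%g = 2%N) ->
    (forall a, a \in C -> separated C a) ->
  nondegenerate_form (@killing_form F _ G C).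
Proof.
move=> CG C2 sep; rewrite /nondegenerate_form killing_formE.
rewrite -row_free_unit; apply: inj_row_free => v vK.
pose S x y : F := \sum_i v 0 i * (x ^ enum_val i == y)%g%:R.
(* This is the expansion of v K v^*, which vanishes because v K = 0. *)
have sq0 : \sum_(x in C) \sum_y `|S x y| ^+ 2 = 0.
  transitivity (\sum_j (v *m \matrix_(i, j)
      (killing G C (enum_val i) (enum_val j))%:R) 0 j * (v 0 j)^*); last first.
    by rewrite vK big1 // => j _; rewrite mxE mul0r.
  transitivity (\sum_(x in C) \sum_j \sum_i
      v 0 i * (x ^ enum_val i == x ^ enum_val j)%g%:R * (v 0 j)^*).
    apply: eq_bigr => x _.
    transitivity (\sum_y \sum_j \sum_i v 0 i * (x ^ enum_val i == y)%g%:R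
        * ((v 0 j)^* * (x ^ enum_val j == y)%g%:R)).
      apply: eq_bigr => y _; rewrite normCK rmorph_sum mulr_sumr.
      by apply: eq_bigr => j _; rewrite rmorphM rmorph_nat mulr_suml.
    rewrite exchange_big; apply: eq_bigr => j _.
    rewrite exchange_big; apply: eq_bigr => i _.
    rewrite (bigD1 (x ^ enum_val j)%g) //= eqxx mulr1 big1 ?addr0 // => y.
    by rewrite eq_sym => /negPf->; rewrite !mulr0.
  rewrite exchange_big; apply: eq_bigr => j _.
  rewrite mxE mulr_suml exchange_big; apply: eq_bigr => i _ /=.
  by rewrite mxE killing_sum ?C2 ?enum_valP // natr_sum mulr_sumr mulr_suml.
apply/rowP => i; rewrite mxE.
(* Only the term of index i survives in S x (x ^ a_i). *)
have [x xC uniq] := sep _ (enum_valP i).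
set y := (x ^ enum_val i)%g in uniq.
have Sxy : S x y = 0.
  apply/eqP; rewrite -normr_eq0 -sqrf_eq0; move/eqP: sq0.
  rewrite psumr_eq0 => [/allP/(_ x)|x' _]; last by apply: sumr_ge0 => y' _; rewrite exprn_ge0.
  rewrite mem_index_enum xC => /(_ isT).
  rewrite psumr_eq0 => [/allP/(_ y)|y' _]; last by rewrite exprn_ge0.
  by rewrite mem_index_enum => /(_ isT).
rewrite -Sxy /S (bigD1 i) //= eqxx mulr1 big1 ?addr0 // => j ji.
case: eqP => [|]; last by rewrite mulr0.
by move/(uniq _ (enum_valP j))/enum_val_inj=> ij; rewrite ij eqxx in ji.
Qed.

(** Commutation makes every entry of K equal to |C|, so that the rows of K
    coincide. *)
Lemma abelian_class_degenerate (F : fieldType) (gT : finGroupType)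
    (G C : {set gT}) (a b : gT) :
    C \subset G -> {in C &, forall x y, commute x y} ->
    a \in C -> b \in C -> a != b ->
  ~~ nondegenerate_form (@killing_form F _ G C).
Proof.
move=> CG Cab aC bC ab; rewrite /nondegenerate_form killing_formE unitmxE.
have KC x y : x \in C -> y \in C -> killing G C x y = #|C|.
  move=> xC yC; apply: eq_card => z; rewrite !in_setI andbC.
  case: (boolP (z \in C)) => //= zC; rewrite (subsetP CG) //=.
  by apply/cent1P; apply: commuteM; apply: Cab.
rewrite (@determinant_alternate _ _ _ (enum_rank_in aC a) (enum_rank_in aC b)) ?unitr0 //.
  by apply: contra ab => /eqP/(congr1 enum_val); rewrite !enum_rankK_in // => ->.
by move=> j; rewrite !mxE !KC ?enum_valP.
Qed.
End KillingGram.

(** * Conjugacy of involutions *)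

Section Involutions.
Set Implicit Arguments.
Unset Strict Implicit.
Unset Printing Implicit Defensive.
Local Open Scope group_scope.

Definition moved (T : finType) (s : {perm T}) : {set T} := [set i | s i != i].

Lemma card_movedJ (T : finType) (s t : {perm T}) : #|moved (s ^ t)| = #|moved s|.
Proof.
rewrite -(card_imset (moved s) (@perm_inj _ t)); apply: eq_card => i.
rewrite -(permKV t i) mem_imset ?inE ?permJ ?(inj_eq (@perm_inj _ t)) //.
exact: perm_inj.
Qed.

Lemma moved_eq0 (T : finType) (s : {perm T}) : (moved s == set0) = (s == 1).
Proof.
apply/eqP/eqP => [/setP s0|->]; last by apply/setP=> i; rewrite !inE perm1 eqxx.
by apply/permP=> i; move: (s0 i); rewrite !inE perm1 => /negbFE/eqP.
Qed.

Lemma card_moved_full (n : nat) (s : 'S_n) : #|moved s| = n <-> forall i, s i != i.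
Proof.
split=> [sn i|sN].
  have /eqP/setP/(_ i) : moved s == setT.
    by rewrite eqEcard subsetT cardsT card_ord sn /=.
  by rewrite !inE.
by rewrite (_ : moved s = setT) ?cardsT ?card_ord //; apply/setP=> i; rewrite !inE sN.
Qed.

(** Involutive permutations include the identity; elements of order 2 do not. *)
Lemma perm_order2P (T : finType) (s : {perm T}) :
  reflect (involutive s /\ moved s != set0) (#[s] == 2).
Proof.
rewrite moved_eq0; apply: (iffP eqP) => [s2|[sK sN]].
  split=> [i|]; first by rewrite -permM -expg2 -s2 expg_order perm1.
  by rewrite -order_eq1 s2.
apply: nt_prime_order => //.
by apply/permP=> i; rewrite expg2 permM perm1 sK.
Qed.

Lemma involutiveJ (T : finType) (s t : {perm T}) : involutive s -> involutive (s ^ t)%g.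
Proof. by move=> sK i; rewrite -(permKV t i) !permJ sK. Qed.

(** Induction on the number of points moved by b where a and b disagree: as
    long as there is one, a can be conjugated so as to acquire another 2-cycle
    of b without losing any. *)
Lemma involution_conj (T : finType) (a b : {perm T}) :
  involutive a -> involutive b -> #|moved a| = #|moved b| -> exists s, b = a ^ s.
Proof.
pose agree (a : {perm T}) := [set i in moved b | a i == b i].
have [m] := ubnP #|moved b :\: agree a|.
elim: m a => // m IHm a + aK bK ab.
have [D0 _|[q]] := set_0Vmem (moved b :\: agree a).
  have bA : moved b \subset agree a by rewrite -setD_eq0 D0.
  have bsa : moved b \subset moved a.
    apply/subsetP=> i ib; have := subsetP bA _ ib.
    by move: ib; rewrite !inE => ib /andP[_ /eqP->].
  have /eqP Eab: moved b == moved a by rewrite eqEcard bsa ab leqnn.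
  exists 1; rewrite conjg1; apply/permP=> i.
  have [/(subsetP bA)|ib] := boolP (i \in moved b).
    by rewrite !inE => /andP[_ /eqP].
  by have := ib; rewrite Eab; move: ib; rewrite !inE !negbK => /eqP-> /eqP->.
move=> qD ltm.
have agA : agree a \subset moved a.
  by apply/subsetP=> i; rewrite !inE => /andP[ib /eqP->].
have agB : agree a \subset moved b.
  by apply/subsetP=> i; rewrite !inE => /andP[].
have [p pD] : exists p, p \in moved a :\: agree a.
  apply/set0Pn; rewrite -card_gt0 cardsD (setIidPr agA) ab.
  have : 0 < #|moved b :\: agree a| by apply/card_gt0P; exists q.
  by rewrite cardsD (setIidPr agB).
have Ja i : i \in agree a -> a i \in agree a.
  by rewrite !inE => /andP[ib /eqP E]; rewrite aK E bK eq_sym ib eqxx.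
have Jb i : i \in agree a -> b i \in agree a.
  by move=> iA; have := Ja _ iA; move: iA; rewrite !inE => /andP[_ /eqP->].
(* t carries the 2-cycle (p, a p) to (q, b q) and fixes the cycles of a that
   are already in place. *)
pose t := tperm p q * tperm (tperm p q (a p)) (b q).
have ap' : a p != p by move: pD; rewrite !inE => /andP[_].
have tp : t p = q.
  rewrite permM tpermL tpermD //.
    by rewrite -[X in _ != X](tpermL p q) (inj_eq (@perm_inj _ _)).
  by move: qD; rewrite !inE => /andP[_].
have tap : t (a p) = b q by rewrite permM tpermL.
have tA i : i \in agree a -> t i = i.
  move=> iA; have ne x : x \notin agree a -> x != i by apply: contraNneq => ->.
  have [pA qA] : p \notin agree a /\ q \notin agree a.
    by move: pD qD; rewrite !(inE, negb_and) => /andP[-> _] /andP[-> _].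
  have apA : a p \notin agree a by apply: contra pA => /Ja; rewrite aK.
  have bqA : b q \notin agree a by apply: contra qA => /Jb; rewrite bK.
  have tapA : tperm p q (a p) \notin agree a by case: tpermP.
  by rewrite permM [tperm p q i]tpermD ?ne // tpermD ?ne //.
have aJ i : (a ^ t) (t i) = t (a i) by rewrite permJ.
have [||||s bE] := IHm (a ^ t) => //; last by exists (t * s); rewrite conjgM.
- apply: leq_trans (_ : #|moved b :\: agree a| <= m)%N => //.
  apply/proper_card/properP; split; last first.
    exists q => //; move: qD; rewrite !inE => /andP[_ bq].
    by rewrite bq -tp aJ tap tp eqxx.
  apply/setDS/subsetP=> i iA; move: (iA); rewrite !inE => /andP[-> /eqP E].
  by rewrite -{1}(tA i iA) aJ tA ?Ja // E eqxx.
- by move=> i; rewrite -(permKV t i) !aJ aK.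
by rewrite card_movedJ.
Qed.

(** Classes of involutions do not split in the alternating group. *)
Lemma involution_class (n : nat) (G : {group 'S_n}) (a b : 'S_n) :
  G = ('Sym_('I_n))%G \/ G = ('Alt_('I_n))%G ->
  #[a] = 2 -> involutive b -> #|moved a| = #|moved b| -> b \in a ^: G.
Proof.
move=> GE /eqP/perm_order2P[aK /set0Pn[p]]; rewrite inE => ap bK /(involution_conj aK bK)[s ->].
have [->|->] := GE; first by rewrite memJ_class ?inE.
have [sodd|seven] := boolP (odd_perm s); last by rewrite memJ_class ?Alt_even.
(* The 2-cycle t of a commutes with a, so it can correct the sign of s. *)
pose t := tperm p (a p).
have at_ : a ^ t = a.
  apply/conjg_fixP/commgP/commute_sym/commgP/conjg_fixP.
  by rewrite tpermJ aK tpermC.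
have -> : a ^ s = a ^ (t * s) by rewrite conjgM at_.
by apply: memJ_class; rewrite Alt_even odd_permM sodd odd_tperm eq_sym ap.
Qed.

(** The points raised by a and those lowered by a are exchanged by a. *)
Lemma even_moved (n : nat) (a : 'S_n) : involutive a -> ~~ odd #|moved a|.
Proof.
move=> aK; pose R := [set i : 'I_n | i < a i].
have -> : moved a = R :|: a @: R.
  apply/setP=> i; rewrite in_setU -{3}(aK i) mem_imset ?inE ?aK; last exact: perm_inj.
  by rewrite -val_eqE /=; lia.
rewrite cardsU disjoint_setI0 ?cards0 ?subn0.
  by rewrite card_imset ?addnn ?odd_double //; apply: perm_inj.
apply/pred0P=> i /=; rewrite -{2}(aK i) mem_imset ?inE ?aK; last exact: perm_inj.
by lia.
Qed.
End Involutions.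

(** * Involutions determined by one conjugation *)

(** The involution (0 1)(2 3)(4 5)... *)
Definition swap_even (i : nat) := if odd i then i.-1 else i.+1.

(** On the path with vertices 0, ..., 2k, the edges {i, i + 1} with i even form
    path_x and those with i odd form path_y; path_a is the reversal. *)
Definition path_x (k i : nat) := if i < k.*2 then swap_even i else i.

Definition path_y (k i : nat) :=
  if 0 < i <= k.*2 then (if odd i then i.+1 else i.-1) else i.

Definition path_a (k i : nat) := if i <= k.*2 then k.*2 - i else i.

(** On the cycle 0, ..., 2q - 1, cycle_y consists of the edges left out by
    swap_even, and cycle_a is the antipodal map (for q = 1 the cycle degenerates
    to one edge of both kinds). Beyond the cycle all are swap_even, which
    provides the 2-cycle shared by both matchings. *)
Definition cycle_y (q i : nat) :=
  if q.*2 <= i then swap_even i else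
  if odd i then (if i.+1 == q.*2 then 0 else i.+1)
  else (if i == 0 then q.*2.-1 else i.-1).

Definition cycle_a (q i : nat) :=
  if q.*2 <= i then swap_even i else if i < q then i + q else i - q.

(** Innermost conditionals are split first, since the conditions of the outer
    ones may contain conditionals themselves. *)
Ltac nat_cases :=
  rewrite /path_x /path_y /path_a /cycle_y /cycle_a /swap_even;
  repeat match goal with |- context [if ?b then _ else _] =>
    lazymatch b with context [if _ then _ else _] => fail | _ => case: (boolP b) => ? end
  end; try lia.

Section UniqueConjugator.
Set Implicit Arguments.
Unset Strict Implicit.
Unset Printing Implicit Defensive.

(** The end 0 of the path is the only point moved by path_x and not by path_y,
    so B maps it to the other end; the remaining values follow along the path,
    since B exchanges the two kinds of edges. *)
Lemma path_unique (n k : nat) (B : nat -> nat) :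
    0 < k -> k.*2 < n ->
    (forall i, i < n -> B (B i) = i) ->
    (forall i, i < n -> path_y k (B i) = B (path_x k i)) ->
    (forall i, i < n -> path_x k (B i) = B (path_y k i)) ->
  forall i, i <= k.*2 -> B i = k.*2 - i.
Proof.
move=> k0 kn BK By Bx.
have B0 : B 0 = k.*2.
  have n0 : 0 < n by lia.
  have n1 : 1 < n by lia.
  have B01 : B 0 <> B 1 by move=> E; have := BK _ n0; rewrite E BK.
  have x0 : path_x k 0 = 1 by nat_cases.
  have y0 : path_y k 0 = 0 by [].
  have := Bx _ n0; have := By _ n0; rewrite x0 y0; nat_cases.
elim=> [|i IHi] ik; first by rewrite B0; lia.
have Bi : B i = k.*2 - i by apply: IHi; lia.
have [io|ie] := boolP (odd i).
  have -> : i.+1 = path_y k i by nat_cases.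
  by rewrite -Bx ?Bi; nat_cases.
have {1}-> : i.+1 = path_x k i by nat_cases.
by rewrite -By ?Bi; nat_cases.
Qed.

(** A map exchanging the two kinds of edges of an alternating cycle is a
    reflection through a vertex or a rotation by an odd amount. *)
Lemma cycle_unique (n q : nat) (B : nat -> nat) :
    odd q -> n = q.*2 \/ n = q.*2.+2 /\ 2 < q ->
    (forall i, i < n -> B i < n) ->
    (forall i, i < n -> B i <> i) ->
    (forall i, i < n -> B (B i) = i) ->
    (forall i, i < n -> cycle_y q (B i) = B (swap_even i)) ->
    (forall i, i < n -> swap_even (B i) = B (cycle_y q i)) ->
  forall i, i < n -> B i = cycle_a q i.
Proof.
move=> qo nq Bn BN BK By Bx.
have n0 : 0 < n by lia.
have n1 : 1 < n by lia.
have s0 : swap_even 0 = 1 by [].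
(* The common 2-cycle, when there is one, is the set where swap_even and
   cycle_y q agree, and B preserves that set. *)
have c_lt : B 0 < q.*2.
  rewrite ltnNge; apply/negP=> c_ge.
  have E : B (swap_even 0) = B (cycle_y q 0).
    by rewrite -Bx // -By // /cycle_y c_ge.
  have : swap_even 0 = cycle_y q 0.
    have BBx : B (B (swap_even 0)) = swap_even 0 by apply: BK.
    have BBy : B (B (cycle_y q 0)) = cycle_y q 0 by apply: BK; nat_cases.
    by rewrite -BBx E BBy.
  have q0 : (q.*2 <= 0) = false by lia.
  by have := Bn _ n0; rewrite s0 /cycle_y q0 /=; lia.
(* For B 0 even, B is the reflection i |-> B 0 - i, with a fixed point. *)
have c_odd : odd (B 0).
  apply/negPn/negP=> ce.
  have Bsub i : i <= B 0 -> B i = B 0 - i.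
    elim: i => [|i IHi] ic; first by lia.
    have Bi : B i = B 0 - i by apply: IHi; lia.
    have [io|ie] := boolP (odd i).
      have {1}-> : i.+1 = cycle_y q i by nat_cases.
      by rewrite -Bx ?Bi; nat_cases.
    have {1}-> : i.+1 = swap_even i by nat_cases.
    by rewrite -By ?Bi; nat_cases.
  by apply: (BN (B 0)./2); [lia | rewrite Bsub; lia].
(* For B 0 odd, B is the rotation by B 0, an involution only if B 0 = q. *)
have Badd i : i < q.*2 -> B i = if B 0 + i < q.*2 then B 0 + i else B 0 + i - q.*2.
  elim: i => [|i IHi] ic; first by nat_cases.
  have Bi := IHi (ltnW ic).
  have [io|ie] := boolP (odd i).
    have {1}-> : i.+1 = cycle_y q i by nat_cases.
    by rewrite -Bx ?Bi; nat_cases.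
  have {1}-> : i.+1 = swap_even i by nat_cases.
  by rewrite -By ?Bi; nat_cases.
have c_eq : B 0 = q.
  by have := Badd _ c_lt; rewrite BK //; nat_cases.
move=> i ilt; have [iq|iq] := ltnP i q.*2.
  by rewrite Badd ?c_eq //; nat_cases.
have BBi := BK _ ilt; have Bni := Bn _ ilt; have BNi := BN _ ilt.
have Bge : q.*2 <= B i.
  rewrite leqNgt; apply/negP=> Blt; have := Badd _ Blt; rewrite BBi c_eq; nat_cases.
nat_cases.
Qed.

Lemma perm_of_nat (n : nat) (f : nat -> nat) :
    (forall i, i < n -> f i < n) -> (forall i, i < n -> f (f i) = i) ->
  exists2 s : 'S_n, involutive s & forall i : 'I_n, s i = f i :> nat.
Proof.
move=> fn fK; pose g (i : 'I_n) := Ordinal (fn i (ltn_ord i)).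
have gK : involutive g by move=> i; apply: val_inj; rewrite /= fK.
exists (perm (inv_inj gK)) => i; last by rewrite permE.
by rewrite !permE gK.
Qed.

Lemma nat_of_perm (n : nat) (s : 'S_n) :
  exists2 f : nat -> nat, (forall i, i < n -> f i < n) & forall i : 'I_n, s i = f i :> nat.
Proof.
exists (fun i => if insub i is Some j then nat_of_ord (s j) else i) => i.
  by move=> ilt; rewrite insubT /=.
by rewrite valK.
Qed.

Lemma card_ord_lt (n m : nat) : m <= n -> #|[set i : 'I_n | i < m]| = m.
Proof.
move=> mn; have winj : injective (widen_ord mn).
  by move=> i j E; apply: val_inj; exact: (congr1 val E).
rewrite -[RHS]card_ord -(card_imset _ winj).
apply: eq_card => i; rewrite inE; apply/idP/imsetP => [im|[j _ ->]].
  by exists (Ordinal im) => //; apply: val_inj.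
exact: (ltn_ord j).
Qed.

Lemma conjg_permP (T : finType) (x y a : {perm T}) :
  reflect (forall i, y (a i) = a (x i)) ((x ^ a)%g == y).
Proof.
apply: (iffP eqP) => [<- i|E]; first by rewrite permJ.
by apply/permP=> i; rewrite -(permKV a i) permJ E.
Qed.

(** The edges of x and of y = x ^ a form an alternating path when some point is
    fixed, and otherwise an alternating cycle of length 2q with q odd, together
    with one shared edge if k is even. That edge must be distinguishable from
    the cycle, i.e. q > 1, which fails just for n = 4, k = 2. *)
Lemma unique_conjugator (n k : nat) :
    0 < k -> k.*2 <= n -> ~ (n = 4 /\ k = 2) ->
  exists x a : 'S_n, [/\ involutive x, involutive a,
    #|moved x| = k.*2, #|moved a| = k.*2 &
    forall b : 'S_n, involutive b -> #|moved b| = k.*2 ->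
      (x ^ b = x ^ a)%g -> b = a].
Proof.
move=> k0 kn nk.
(* The two conditions on b, read on the natural numbers below n. *)
have natP (x y b : 'S_n) (B xf yf : nat -> nat) :
    (forall i, i < n -> xf i < n) -> (forall i, i < n -> yf i < n) ->
    (forall i : 'I_n, x i = xf i :> nat) -> (forall i : 'I_n, y i = yf i :> nat) ->
    (forall i : 'I_n, b i = B i :> nat) -> involutive b -> (x ^ b)%g = y ->
  [/\ forall i, i < n -> B (B i) = i,
      forall i, i < n -> yf (B i) = B (xf i) &
      forall i, i < n -> xf (B i) = B (yf i)].
  move=> xn yn xE yE bE bK /eqP/conjg_permP xby.
  have xby' i : x (b i) = b (y i) by rewrite -{2}(bK i) xby bK.
  split=> i ilt.
  - by rewrite -[RHS](congr1 val (bK (Ordinal ilt))) /= !bE.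
  - by have := congr1 val (xby (Ordinal ilt)); rewrite /= yE !bE xE.
  by have := congr1 val (xby' (Ordinal ilt)); rewrite /= xE !bE yE.
have [k2n|k2n] : k.*2 < n \/ n = k.*2 by lia.
  have [||x xK xE] := @perm_of_nat n (path_x k); try by move=> i ilt; nat_cases.
  have [||y yK yE] := @perm_of_nat n (path_y k); try by move=> i ilt; nat_cases.
  have [||a aK aE] := @perm_of_nat n (path_a k); try by move=> i ilt; nat_cases.
  have xa : (x ^ a)%g = y.
    apply/eqP/conjg_permP => i; apply: ord_inj; rewrite yE !aE xE.
    by have := ltn_ord i; nat_cases.
  (* a fixes k and nothing else below 2k + 1. *)
  have am : #|moved a| = k.*2.
    have kn' : k < n by lia.
    have := card_ord_lt k2n; rewrite (cardsD1 (Ordinal kn')) inE /=.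
    rewrite (_ : k < k.*2.+1) ?add1n => [[<-]|]; last by lia.
    apply: eq_card => i; rewrite !inE -!val_eqE /= aE.
    by have := ltn_ord i; nat_cases.
  exists x, a; split=> //.
  - rewrite -(card_ord_lt kn); apply: eq_card => i; rewrite !inE -val_eqE /= xE.
    by nat_cases.
  move=> b bK bm; rewrite xa => xb.
  have [B Bn bE] := nat_of_perm b.
  have [] := natP x y b B _ _ _ _ xE yE bE bK xb; try by move=> i ilt; nat_cases.
  move=> BK By Bx; have BA := path_unique k0 k2n BK By Bx.
  have ab (i : 'I_n) : i <= k.*2 -> b i = a i.
    by move=> ik; apply: ord_inj; rewrite bE aE BA // /path_a ik.
  have a_id (i : 'I_n) : k.*2 < i -> a i = i.
    by move=> ik; apply: ord_inj; rewrite aE /path_a leqNgt ik.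
  have /eqP Eab : moved a == moved b.
    rewrite eqEcard bm am leqnn andbT; apply/subsetP=> i; rewrite !inE.
    by have [/ab->|/a_id->] := leqP i k.*2; rewrite ?eqxx.
  apply/permP=> i; have [/ab //|/a_id ai] := leqP i k.*2.
  have : i \notin moved b by rewrite -Eab inE ai eqxx.
  by rewrite inE ai negbK => /eqP.
(* Here n = 2k. The cycle has length 2q with q odd, so that its antipodal map
   exchanges the two matchings; for k even one 2-cycle is set apart. *)
pose q := if odd k then k else k.-1.
have qo : odd q by rewrite /q; case: ifP; lia.
have nq : n = q.*2 \/ n = q.*2.+2 /\ 2 < q by rewrite /q; case: ifP; lia.
have [||x xK xE] := @perm_of_nat n swap_even; try by move=> i ilt; nat_cases.
have [||y yK yE] := @perm_of_nat n (cycle_y q); try by move=> i ilt; nat_cases.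
have [||a aK aE] := @perm_of_nat n (cycle_a q); try by move=> i ilt; nat_cases.
exists x, a; split=> //.
- rewrite -k2n; apply/(card_moved_full _).2 => i; rewrite -val_eqE /= xE.
  by nat_cases.
- rewrite -k2n; apply/(card_moved_full _).2 => i; rewrite -val_eqE /= aE.
  by nat_cases.
have xa : (x ^ a)%g = y.
  apply/eqP/conjg_permP => i; apply: ord_inj; rewrite yE !aE xE.
  by have := ltn_ord i; nat_cases.
move=> b bK; rewrite -k2n xa => /card_moved_full bN xb.
have [B Bn bE] := nat_of_perm b.
have [] := natP x y b B _ _ _ _ xE yE bE bK xb; try by move=> i ilt; nat_cases.
move=> BK By Bx; apply/permP=> i; apply: ord_inj; rewrite bE aE.
have BN j : j < n -> B j <> j.
  by move=> jlt E; have /eqP[] := bN (Ordinal jlt); apply: ord_inj; rewrite bE.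
exact: cycle_unique qo nq Bn BN BK By Bx _ (ltn_ord i).
Qed.
End UniqueConjugator.

(** * The class of double transpositions in degree 4 *)

Section DegreeFour.
Set Implicit Arguments.
Unset Strict Implicit.
Unset Printing Implicit Defensive.
Import GroupScope.

Lemma double_transpositionE (i : 'I_4) : double_transposition i = swap_even i :> nat.
Proof.
have ne (j k : nat) : (j < 4)%N -> (k < 4)%N -> j != k -> (inord j : 'I_4) != inord k.
  by move=> j4 k4; rewrite -val_eqE /= !inordK.
rewrite -(inord_val i) permM; case: i => /= [[|[|[|[|//]]]] _]; rewrite ?inordK //.
- by rewrite tpermL tpermD ?ne // inordK.
- by rewrite tpermR tpermD ?ne // inordK.
- by rewrite (@tpermD _ _ _ (inord 2)) ?ne // tpermL inordK.
- by rewrite (@tpermD _ _ _ (inord 3)) ?ne // tpermR inordK.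
Qed.

Lemma double_transpositionK : involutive double_transposition.
Proof. by move=> i; apply: ord_inj; rewrite !double_transpositionE; nat_cases. Qed.

Lemma card_moved_double_transposition : #|moved double_transposition| = 4.
Proof.
by apply/(card_moved_full _).2 => i; rewrite -val_eqE /= double_transpositionE; nat_cases.
Qed.

(** If x i <> y i, both x (y i) and y (x i) are the point distinct from i, x i
    and y i. *)
Lemma commute_fixfree_involutions (x y : 'S_4) :
    involutive x -> involutive y -> #|moved x| = 4 -> #|moved y| = 4 ->
  commute x y.
Proof.
move=> xK yK /card_moved_full xN /card_moved_full yN.
apply/permP=> i; rewrite !permM; have [E|xy] := eqVneq (x i) (y i).
  by rewrite E yK -E xK.
have xyx : y (x i) != y i by rewrite (inj_eq (@perm_inj _ _)).
have yxy : x (y i) != x i by rewrite (inj_eq (@perm_inj _ _)).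
have yxi : y (x i) != i by rewrite -{2}(yK i) (inj_eq (@perm_inj _ _)).
have xyi : x (y i) != i by rewrite -{2}(xK i) (inj_eq (@perm_inj _ _)) eq_sym.
apply: ord_inj; move: xyx yxy yxi xyi xy (xN i) (yN i) (xN (y i)) (yN (x i)).
rewrite -!val_eqE /=; have := ltn_ord i; have := ltn_ord (x i); have := ltn_ord (y i).
have := ltn_ord (x (y i)); have := ltn_ord (y (x i)).
by lia.
Qed.

Lemma double_transposition_degenerate (F : fieldType) (G : {group 'S_4}) :
    G = ('Sym_('I_4))%G \/ G = ('Alt_('I_4))%G ->
    double_transposition \in G ->
  ~~ nondegenerate_form (@killing_form F _ G (double_transposition ^: G)%g).
Proof.
set d := double_transposition => GE dG.
have dK := double_transpositionK; have dm := card_moved_double_transposition.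
pose t : 'S_4 := tperm (inord 0) (inord 2).
apply: (@abelian_class_degenerate _ _ _ _ d (d ^ t)%g).
- by rewrite class_subG.
- move=> _ _ /imsetP[g _ ->] /imsetP[h _ ->].
  by apply: commute_fixfree_involutions; rewrite ?card_movedJ //; apply: involutiveJ.
- exact: class_refl.
- apply: involution_class; rewrite ?card_movedJ //.
    by apply/eqP/perm_order2P; split=> //; rewrite -card_gt0 dm.
  exact: involutiveJ.
apply/eqP=> /permP/(_ (inord 0)); rewrite -[in RHS](tpermR (inord 0) (inord 2)) permJ -/t.
have d2 : d (inord 2) = inord 3 by apply: ord_inj; rewrite double_transpositionE !inordK.
move=> /(congr1 val); rewrite /= double_transpositionE d2 tpermD ?inordK //.
  by rewrite -val_eqE /= !inordK.
by rewrite -val_eqE /= !inordK.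
Qed.
End DegreeFour.

(** * The theorem *)

Theorem theorem1p5 (R : realType) (n : nat) (hn : (2 <= n)%N)
  (G : {group 'S_n}) (hG : G = ('Sym_('I_n))%G \/ G = ('Alt_('I_n))%G)
  (C : {set 'S_n}) (hC : C \in classes G)
  (hinv : forall x : 'S_n, x \in C -> #[x]%g = 2%N) :
  nondegenerate_form (@killing_form R[i] _ G C) <->
  ~ (exists e : 4 = n, C = (cast_perm e double_transposition ^: G)%g).
Proof.
have [c cG CE] := imsetP hC; have CG : C \subset G by rewrite CE class_subG.
have CJ x g : x \in C -> g \in G -> (x ^ g)%g \in C.
  by move=> xC gG; move: xC; rewrite CE memJ_norm // (subsetP (class_norm c G)).
have cC : c \in C by rewrite CE class_refl.
have CK x : x \in C -> involutive x by move=> /hinv/eqP/perm_order2P[].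
split=> [nd [e CdE]|not_exc].
  subst n; move: CdE nd; rewrite cast_perm_id => CdE; apply/negP; rewrite CdE.
  apply: double_transposition_degenerate => //.
  by apply: (subsetP CG); rewrite CdE class_refl.
have in_class (b : 'S_n) : involutive b -> #|moved b| = #|moved c| -> b \in C.
  by move=> bK bc; rewrite CE involution_class ?hinv.
have [k mk] : exists k, #|moved c| = k.*2.
  exists #|moved c|./2; have := even_moved (CK _ cC); lia.
have Cm b : b \in C -> #|moved b| = k.*2.
  by rewrite CE => /imsetP[g _ ->]; rewrite card_movedJ.
have k_gt0 : (0 < k)%N.
  by have /eqP/perm_order2P[_] := hinv _ cC; rewrite -card_gt0; lia.
have kn : (k.*2 <= n)%N by rewrite -mk -[leqRHS]card_ord max_card.
have nk : ~ (n = 4 /\ k = 2).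
  case=> n4 k2; apply: not_exc; exists (esym n4).
  rewrite CE; apply/esym/class_eqP; rewrite -CE; apply: in_class.
    by move=> i; subst n; rewrite cast_perm_id double_transpositionK.
  rewrite mk k2; move: (esym n4) => e; subst n.
  by rewrite cast_perm_id card_moved_double_transposition.
have [x [a [xK aK xm am uniq]]] := unique_conjugator k_gt0 kn nk.
have xC : x \in C by apply: in_class; rewrite ?xm.
have aC : a \in C by apply: in_class; rewrite ?am.
apply: separated_nondegenerate => // b bC.
have /imsetP[g gG ->] : b \in (a ^: G)%g.
  by apply: involution_class => //; [exact: hinv | exact: CK | rewrite am Cm].
exists (x ^ g)%g; first exact: CJ.
move=> h hC' E; have hgC : (h ^ g^-1)%g \in C by rewrite CJ ?groupV.
rewrite -(uniq (h ^ g^-1)%g) ?conjgKV //; [exact: CK | exact: Cm |].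
by apply: (conjg_inj g); rewrite [LHS]conjJg conjgKV E [RHS]conjJg.
Qed.
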